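(* For every group $G$ there exist infinitely many pointed Alexandroff spaces $(X,x)$, whose underlying spaces $X$ are pairwise non-homotopy-equivalent, such that the group $\mathcal{E}((X,x))$ of pointed homotopy classes of pointed self-homotopy equivalences of $(X,x)$ is isomorphic to $G$.
   Context: An Alexandroff space is a topological space in which arbitrary intersections of open sets are open. For a pointed topological space $(X,x)$, $\mathcal{E}((X,x))$ denotes the group of pointed homotopy classes of pointed self-homotopy equivalences $(X,x)\to(X,x)$, with the operation induced by composition; equivalently, the automorphism group of $(X,x)$ in the pointed homotopy category of pointed topological spaces. *)

(* Defs.v *)
From HB Require Import structures.
From mathcomp Require Import all_boot all_order all_algebra generic_quotient.
From mathcomp Require Import mathcomp_extra boolp classical_sets functions.
From mathcomp Require Import set_interval reals topology normedtype.

Set Implicit Arguments.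
Unset Strict Implicit.
Unset Printing Implicit Defensive.

Import Order.TTheory GRing.Theory Num.Theory.
Import numFieldNormedType.Exports.

Local Open Scope classical_set_scope.
Local Open Scope ring_scope.
Local Open Scope quotient_scope.

Definition alexandroff (X : topologicalType) : Prop :=
  forall A : set (set X), (forall U, A U -> open U) ->
    open (\bigcap_(U in A) U).

(* [R] plays the role of the real line, all models of which are isomorphic;
   it is a parameter throughout because homotopies are indexed by `[0, 1]. *)
Definition cylinder (R : realType) (X : topologicalType) : set (X * R) :=
  [set: X] `*` `[0, 1]%classic.
Arguments cylinder : clear implicits.

(* Homotopies relative to [A]: [A := set0] gives free homotopies, and
   [A := [set point]] gives pointed homotopies between pointed maps. Only the
   values of [H] on [cylinder R X] are relevant. *)
Definition homotopic_rel (R : realType) (X Y : topologicalType) (A : set X)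
    (f g : X -> Y) : Prop :=
  exists H : X * R -> Y,
    [/\ {within cylinder R X, continuous H},
        forall x, H (x, 0) = f x,
        forall x, H (x, 1) = g x &
        forall a t, A a -> t \in `[0, 1] -> H (a, t) = f a].

Definition homotopic (R : realType) (X Y : topologicalType)
    (f g : X -> Y) : Prop :=
  homotopic_rel R set0 f g.

Definition homotopy_equivalent (R : realType) (X Y : topologicalType) : Prop :=
  exists (f : X -> Y) (g : Y -> X),
    [/\ continuous f, continuous g,
        homotopic R (g \o f) idfun & homotopic R (f \o g) idfun].

Definition pointed_map (X Y : ptopologicalType) (f : X -> Y) : Prop :=
  continuous f /\ f point = point.

Definition pointed_homotopic (R : realType) (X Y : ptopologicalType)
    (f g : X -> Y) : Prop :=
  homotopic_rel R [set point] f g.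

Definition pointed_homotopy_inverse (R : realType) (X Y : ptopologicalType)
    (f : X -> Y) (g : Y -> X) : Prop :=
  [/\ pointed_map g, pointed_homotopic R (g \o f) idfun
    & pointed_homotopic R (f \o g) idfun].

Definition pointed_homotopy_equivalence (R : realType)
    (X Y : ptopologicalType) (f : X -> Y) : Prop :=
  pointed_map f /\ exists g, pointed_homotopy_inverse R f g.

Section homotopic_rel_theory.
Context {R : realType}.
Implicit Types X Y Z : topologicalType.

Lemma within_comp X Y Z (A : set X) (B : set Y) (h : X -> Y) (f : Y -> Z) :
  continuous h -> (forall x, A x -> B (h x)) ->
  {within B, continuous f} -> {within A, continuous (f \o h)}.
Proof.
move=> ch AB /subspace_continuousP cf; apply/subspace_continuousP => x Ax.
apply: (@cvg_comp _ _ _ h f _ (within B (nbhs (h x))));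
  last exact: cf (AB _ Ax).
move=> W hW.
have hW' : nbhs x [set y | B (h y) -> W (h y)] := ch x _ hW.
rewrite /= /within /=.
by apply: filterS hW' => y /= yW /AB; exact: yW.
Qed.

Lemma continuous_pair X Y Z (f : X -> Y) (g : X -> Z) :
  continuous f -> continuous g -> continuous (fun x => (f x, g x)).
Proof. by move=> cf cg x; exact: (cvg_pair (cf x) (cg x)). Qed.

Lemma continuous_fst X Y : continuous (fun p : X * Y => p.1).
Proof. by move=> p; exact: cvg_fst. Qed.

Lemma continuous_snd X Y : continuous (fun p : X * Y => p.2).
Proof. by move=> p; exact: cvg_snd. Qed.

Lemma homotopic_rel_refl X Y (A : set X) (f : X -> Y) :
  continuous f -> homotopic_rel R A f f.
Proof.
move=> cf; exists (f \o fst); split => //.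
apply: continuous_subspaceT => x.
by apply: continuous_comp; [exact: continuous_fst | exact: cf].
Qed.

Lemma homotopic_rel_sym X Y (A : set X) (f g : X -> Y) :
  homotopic_rel R A f g -> homotopic_rel R A g f.
Proof.
move=> [H [cH H0 H1 HA]].
have fgA a : A a -> f a = g a by move=> Aa; rewrite -H1 HA // in_itv/= lexx ler01.
exists (H \o (fun p : X * R => (p.1, 1 - p.2))); split => /=.
- apply: (@within_comp _ _ _ _ (cylinder R X)) => //.
    apply: continuous_pair => [|p]; first exact: continuous_fst.
    by apply: cvgB; [exact: cvg_cst | exact: continuous_snd].
  move=> [x t] /= [_]; rewrite /= !in_itv/= => /andP[t0 t1]; split => //=.
  by rewrite in_itv/= subr_ge0 t1 gerBl t0.
- by move=> x; rewrite subr0.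
- by move=> x; rewrite subrr.
- move=> a t Aa; rewrite in_itv/= => /andP[t0 t1].
  by rewrite HA ?fgA// in_itv/= subr_ge0 t1 gerBl t0.
Qed.

Lemma homotopic_rel_trans X Y (A : set X) (f g h : X -> Y) :
  homotopic_rel R A f g -> homotopic_rel R A g h -> homotopic_rel R A f h.
Proof.
move=> [H [cH H0 H1 HA]] [K [cK K0 K1 KA]].
have fgA a : A a -> f a = g a by move=> Aa; rewrite -H1 HA // in_itv/= lexx ler01.
pose h1 (p : X * R) : X * R := (p.1, 2 * p.2).
pose h2 (p : X * R) : X * R := (p.1, 2 * p.2 - 1).
pose L (p : X * R) := if p.2 <= 2^-1 then H (h1 p) else K (h2 p).
have h20 : (2 : R) * 2^-1 = 1 by rewrite divff ?pnatr_eq0.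
have i2 : 0 < (2^-1 : R) by rewrite invr_gt0.
have i21 : (2^-1 : R) <= 1 by rewrite invf_le1// ler1n.
have ch1 : continuous h1.
  apply: continuous_pair => [|p]; first exact: continuous_fst.
  by apply: cvgM; [exact: cvg_cst | exact: continuous_snd].
have ch2 : continuous h2.
  apply: continuous_pair => [|p]; first exact: continuous_fst.
  apply: cvgB; last exact: cvg_cst.
  by apply: cvgM; [exact: cvg_cst | exact: continuous_snd].
have LE1 p : p.2 <= 2^-1 -> L p = H (h1 p) by rewrite /L => ->.
have LE2 p : 2^-1 <= p.2 -> L p = K (h2 p).
  rewrite /L /h1 /h2 le_eqVlt => /orP[/eqP <-|]; last by rewrite ltNge => /negbTE ->.
  by rewrite lexx h20 subrr H1 K0.
have le2 (t : R) : (2 * t <= 1) = (t <= 2^-1).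
  by rewrite -[RHS](ler_pM2l (@ltr0Sn R 1)) h20.
have ge2 (t : R) : (1 <= 2 * t) = (2^-1 <= t).
  by rewrite -[RHS](ler_pM2l (@ltr0Sn R 1)) h20.
have le21 (t : R) : (2 * t - 1 <= 1) = (t <= 1).
  by rewrite lerBlDr -[RHS](ler_pM2l (@ltr0Sn R 1)) mulr1.
exists L; split.
- have -> : cylinder R X =
      ([set: X] `*` `[0, 2^-1]%classic) `|` ([set: X] `*` `[2^-1, 1]%classic).
    apply/seteqP; split=> -[x t] /=.
      move=> [_]; rewrite /= in_itv/= => /andP[t0 t1].
      have [tl|/ltW tl] := leP t 2^-1; [left|right]; split => //=;
        by rewrite in_itv/= ?t0 ?t1 ?tl.
    move=> [] [_] /=; rewrite in_itv/= => /andP[a b]; split => //=;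
      rewrite in_itv/= ?a ?b ?andbT/=.
    + exact: le_trans b i21.
    + exact: le_trans (ltW i2) a.
  have clX (a b : R) : closed ([set: X] `*` `[a, b]%classic).
    have -> : [set: X] `*` `[a, b]%classic = snd @^-1` `[a, b]%classic :> set (X * R).
      by apply/seteqP; split=> -[x t] //= [].
    apply: closed_comp; last exact: interval_closed.
    by move=> p _; exact: continuous_snd.
  apply: withinU_continuous; [exact: clX|exact: clX| |].
  + apply: (@subspace_eq_continuous _ _ _ (H \o h1)).
      move=> [x t]; rewrite inE => -[_] /=; rewrite in_itv/= => /andP[_ t1].
      by rewrite /from_subspace /= LE1.
    apply: (@within_comp _ _ _ _ (cylinder R X)) => //.
    move=> [x t] [_] /=; rewrite in_itv/= => /andP[t0 t1]; split => //=.
    by rewrite in_itv/= le2 t1 mulr_ge0.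
  + apply: (@subspace_eq_continuous _ _ _ (K \o h2)).
      move=> [x t]; rewrite inE => -[_] /=; rewrite in_itv/= => /andP[t1 _].
      by rewrite /from_subspace /= LE2.
    apply: (@within_comp _ _ _ _ (cylinder R X)) => //.
    move=> [x t] [_] /=; rewrite in_itv/= => /andP[t0 t1]; split => //=.
    by rewrite in_itv/= subr_ge0 ge2 t0 le21.
- by move=> x; rewrite LE1 /h1 /= ?mulr0 ?H0// ltW.
- by move=> x; rewrite LE2 /h2 //= mulr1 -{1}[2]/(1 + 1) addrK K1.
- move=> a t Aa; rewrite in_itv/= => /andP[t0 t1].
  have [tl|/ltW tl] := leP t 2^-1.
    by rewrite LE1// HA// in_itv/= le2 tl mulr_ge0.
  by rewrite LE2// KA ?fgA// in_itv/= subr_ge0 ge2 tl le21.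
Qed.

Lemma homotopic_rel_compl X Y Z (A : set X) (f g : X -> Y) (k : Y -> Z) :
  continuous k -> homotopic_rel R A f g -> homotopic_rel R A (k \o f) (k \o g).
Proof.
move=> ck [H [cH H0 H1 HA]]; exists (k \o H); split => /=.
- apply/subspace_continuousP => x Cx.
  apply: (@cvg_comp _ _ _ H k _ (nbhs (H x))); last exact: ck.
  by move/subspace_continuousP: cH; exact.
- by move=> x; rewrite H0.
- by move=> x; rewrite H1.
- by move=> a t Aa t01; rewrite HA.
Qed.

Lemma homotopic_rel_compr X Y Z (A : set X) (B : set Y) (k : X -> Y)
    (f g : Y -> Z) :
  continuous k -> (forall x, A x -> B (k x)) ->
  homotopic_rel R B f g -> homotopic_rel R A (f \o k) (g \o k).
Proof.
move=> ck AB [H [cH H0 H1 HB]].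
exists (H \o (fun p : X * R => (k p.1, p.2))); split => //=.
- apply: (@within_comp _ _ _ _ (cylinder R Y) _ H); last exact: cH.
  + apply: continuous_pair => [p|]; last exact: continuous_snd.
    by apply: continuous_comp; [exact: continuous_fst | exact: ck].
  + by move=> p [].
- by move=> a t Aa; apply: HB; exact: AB.
Qed.

End homotopic_rel_theory.

Section pointed_theory.
Context {R : realType}.
Implicit Types X Y Z : ptopologicalType.

Lemma pointed_map_id X : pointed_map (@idfun X).
Proof. by split => // x; exact: cvg_id. Qed.

Lemma pointed_map_comp X Y Z (g : Y -> Z) (f : X -> Y) :
  pointed_map g -> pointed_map f -> pointed_map (g \o f).
Proof.
move=> [cg g0] [cf f0]; split; last by rewrite /= f0.
by move=> x; apply: continuous_comp; [exact: cf | exact: cg].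
Qed.

Lemma pointed_homotopic_comp X Y Z (g g' : Y -> Z) (f f' : X -> Y) :
  pointed_map g' -> pointed_map f ->
  pointed_homotopic R g g' -> pointed_homotopic R f f' ->
  pointed_homotopic R (g \o f) (g' \o f').
Proof.
move=> [cg' _] [cf f0] gg' ff'; apply: (@homotopic_rel_trans _ _ _ _ _ (g' \o f)).
  by apply: homotopic_rel_compr gg' => // x ->.
exact: homotopic_rel_compl.
Qed.

Lemma pointed_homotopy_equivalence_id X :
  pointed_homotopy_equivalence R (@idfun X).
Proof.
split; first exact: pointed_map_id.
by exists idfun; split; [exact: pointed_map_id | |];
  apply: homotopic_rel_refl => x; exact: cvg_id.
Qed.

Lemma pointed_homotopy_equivalence_comp X Y Z (g : Y -> Z) (f : X -> Y) :
  pointed_homotopy_equivalence R g -> pointed_homotopy_equivalence R f ->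
  pointed_homotopy_equivalence R (g \o f).
Proof.
move=> [pg [g' [pg' g'g gg']]] [pf [f' [pf' f'f ff']]].
split; first exact: pointed_map_comp.
exists (f' \o g'); split; first exact: pointed_map_comp.
- apply: homotopic_rel_trans f'f.
  apply: (@homotopic_rel_compl _ _ _ _ _ ((g' \o g) \o f) f); first by case: pf'.
  by apply: (@homotopic_rel_compr _ _ _ _ _ [set point] f _ idfun) => //;
    case: pf => // _ f0 x ->.
- apply: homotopic_rel_trans gg'.
  apply: (@homotopic_rel_compl _ _ _ _ _ ((f \o f') \o g') g'); first by case: pg.
  by apply: (@homotopic_rel_compr _ _ _ _ _ [set point] g' _ idfun) => //;
    case: pg' => // _ g'0 x ->.
Qed.

Lemma pointed_homotopy_equivalence_inv X Y (f : X -> Y) (g : Y -> X) :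
  pointed_map f -> pointed_homotopy_inverse R f g ->
  pointed_homotopy_equivalence R g.
Proof. by move=> pf [pg gf fg]; split => //; exists f. Qed.

End pointed_theory.

Section self_equivalence_group.
Context (R : realType) (X : ptopologicalType).

Definition self_equivalence : set (X -> X) :=
  [set f | pointed_homotopy_equivalence R f].

Implicit Types f g : self_equivalence.

Lemma self_equivalenceP f : pointed_homotopy_equivalence R (val f).
Proof. exact: set_mem (valP f). Qed.

Let pm f : pointed_map (val f). Proof. by case: (self_equivalenceP f). Qed.

Definition self_equivalence_one : self_equivalence :=
  SigSub (mem_set (@pointed_homotopy_equivalence_id R X)).

Definition self_equivalence_mul f g : self_equivalence :=
  SigSub (mem_set (pointed_homotopy_equivalence_comp
    (self_equivalenceP f) (self_equivalenceP g))).

Definition self_equivalence_inv f : self_equivalence :=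
  let fP := self_equivalenceP f in
  SigSub (mem_set (pointed_homotopy_equivalence_inv fP.1 (projT2 (cid fP.2)))).

Definition self_homotopic f g : bool :=
  `[< pointed_homotopic R (val f) (val g) >].

Lemma self_homotopic_refl : reflexive self_homotopic.
Proof. by move=> f; apply/asboolP/homotopic_rel_refl; case: (pm f). Qed.

Lemma self_homotopic_sym : symmetric self_homotopic.
Proof. by move=> f g; apply/asboolP/asboolP; exact: homotopic_rel_sym. Qed.

Lemma self_homotopic_trans : transitive self_homotopic.
Proof.
by move=> g f h /asboolP fg /asboolP gh; apply/asboolP;
  exact: homotopic_rel_trans fg gh.
Qed.

Canonical self_homotopic_equiv :=
  EquivRel self_homotopic self_homotopic_refl self_homotopic_sym
    self_homotopic_trans.

Definition self_equivalence_group : Type := {eq_quot self_homotopic}.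

HB.instance Definition _ := Choice.on self_equivalence_group.
HB.instance Definition _ := EqQuotient.on self_equivalence_group.

Local Notation E := self_equivalence_group.

Definition self_one : E := \pi_E self_equivalence_one.
Definition self_mul (a b : E) : E :=
  \pi_E (self_equivalence_mul (repr a) (repr b)).
Definition self_inv (a : E) : E := \pi_E (self_equivalence_inv (repr a)).

Lemma self_pi_eq f g :
  pointed_homotopic R (val f) (val g) <-> \pi_E f = \pi_E g.
Proof.
split=> [fg|/eqP]; first by apply/eqP; rewrite eqmodE; exact/asboolP.
by rewrite eqmodE => /asboolP.
Qed.

Lemma self_pi_mul f g :
  self_mul (\pi_E f) (\pi_E g) = \pi_E (self_equivalence_mul f g).
Proof.
apply/self_pi_eq/pointed_homotopic_comp; [exact: pm|exact: pm| |];
  by apply/self_pi_eq; rewrite reprK.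
Qed.

Lemma self_mulA : associative self_mul.
Proof.
elim/quotW=> f; elim/quotW=> g; elim/quotW=> h.
rewrite (self_pi_mul g h) (self_pi_mul f g) !self_pi_mul.
by apply: (congr1 \pi_E); exact: val_inj.
Qed.

Lemma self_mul1 : left_id self_one self_mul.
Proof.
elim/quotW=> f; rewrite self_pi_mul.
by apply: (congr1 \pi_E); exact: val_inj.
Qed.

Lemma self_mulr1 : right_id self_one self_mul.
Proof.
elim/quotW=> f; rewrite self_pi_mul.
by apply: (congr1 \pi_E); exact: val_inj.
Qed.

Lemma self_mulV : left_inverse self_one self_inv self_mul.
Proof.
move=> a; rewrite -[X in self_mul _ X]reprK self_pi_mul; apply/self_pi_eq.
by rewrite /=; case: cid => g [].
Qed.

Lemma self_mulrV : right_inverse self_one self_inv self_mul.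
Proof.
move=> a; rewrite -[X in self_mul X _]reprK self_pi_mul; apply/self_pi_eq.
by rewrite /=; case: cid => g [].
Qed.

HB.instance Definition _ := isGroup.Build self_equivalence_group
  self_mulA self_mul1 self_mulr1 self_mulV self_mulrV.

End self_equivalence_group.
Arguments self_equivalence : clear implicits.

Definition group_isomorphic (G H : groupType) : Prop :=
  exists phi : {multiplicative G -> H}, bijective phi.

(* Main.v *)
(* A poset of height one, with its down-sets as open sets, admits no homotopy
   starting at the identity other than the constant one as soon as every point
   lies on a 4-cycle of its Hasse diagram.  In such spaces homotopy equivalences
   are isomorphisms and pointed homotopy classes of self-equivalences are
   automorphisms fixing the base point.  So it suffices to realize [G] as the
   group of those automorphisms for one such poset, and then to make the poset
   arbitrarily large.

   The realization encodes the 3-net of [G]: the minimal points are the rows,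
   the columns and the "colours", the maximal points are the cells
   [(g, h) \in G * G], and a cell lies above its row [g], its column [h] and
   its colour [g^-1 * h].  Automorphisms preserving rows and columns and
   fixing every colour are the left translations.  The colours are pinned down
   by a well-order, which has no automorphism.  Colours belonging to no cell may
   be added freely; adding a powerset worth of them at each step yields spaces
   of different cardinalities. *)
Require Import Defs.
From HB Require Import structures.
From mathcomp Require Import all_boot all_order all_algebra generic_quotient.
From mathcomp Require Import boolp classical_sets wochoice.
From mathcomp Require Import reals topology normedtype.

Set Implicit Arguments.
Unset Strict Implicit.
Unset Printing Implicit Defensive.

Import Order.TTheory GRing.Theory Num.Theory.
Import numFieldNormedType.Exports.

Local Open Scope classical_set_scope.

(** * Down-set topologies of posets of height one *)

Section downset_topology.
Context (X : topologicalType) (lt : X -> X -> Prop).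
Context (openE : forall U : set X,
  open U <-> (forall x y, lt x y -> U y -> U x)).
Context (lt_height1 : forall x y z, lt x y -> ~ lt y z).

Let le x y := x = y \/ lt x y.

Lemma downset_alexandroff : alexandroff X.
Proof.
move=> A Ao; apply/openE => x y xy Ay U AU.
by move/openE: (Ao _ AU); apply; [exact: xy | exact: Ay].
Qed.

Lemma open_downset c : open [set z | le z c].
Proof.
by apply/openE => x y xy [<-|yc]; [right|case: (lt_height1 xy yc)].
Qed.

Lemma closed_upset c : closed [set z | le c z].
Proof.
rewrite -openC; apply/openE => x y xy ncy /= [cx|cx]; apply: ncy.
  by right; rewrite cx.
by case: (lt_height1 cx xy).
Qed.

End downset_topology.

Lemma continuous_monotone (X Y : topologicalType) (ltX : X -> X -> Prop)
    (ltY : Y -> Y -> Prop) (f : X -> Y) x y :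
  (forall U : set X, open U <-> (forall x y, ltX x y -> U y -> U x)) ->
  (forall U : set Y, open U <-> (forall x y, ltY x y -> U y -> U x)) ->
  (forall x y z, ltY x y -> ~ ltY y z) ->
  continuous f -> ltX x y -> f x = f y \/ ltY (f x) (f y).
Proof.
move=> oX oY hY /continuousP /(_ _ (open_downset oY hY (f y))) /oX fo xy.
by apply: (fo x y xy); left.
Qed.

(** * Rigidity of homotopies on squares *)

Section square_rigidity.
Context (X : topologicalType) (lt : X -> X -> Prop).
Context (openE : forall U : set X,
  open U <-> (forall x y, lt x y -> U y -> U x)).
Context (lt_height1 : forall x y z, lt x y -> ~ lt y z).

Let le x y := x = y \/ lt x y.

(** A 4-cycle of the Hasse diagram; naming only [v] and [w] loses nothing, since the two lower and
    the two upper corners are interchangeable. *)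
Definition on_square x := exists v v' w w',
  [/\ v <> v', w <> w', lt v w & lt v w']
  /\ [/\ lt v' w, lt v' w' & x = v \/ x = w].

Context (R : realType).

(* The times at which all four corners of a square are fixed form a clopen
   subset of `[0, 1]: given monotonicity, it suffices that each corner moves
   down (an open condition), or that each moves up (a closed condition). *)
Lemma homotopy_fixes_square (H : X * R -> X) x :
  {within cylinder R X, continuous H} -> (forall y, H (y, 0%R) = y) ->
  on_square x -> H (x, 1%R) = x.
Proof.
move=> cH H0 [v [v' [w [w' [[vv' ww' vw vw'] [v'w v'w' xvw]]]]]].
pose I : set R := `[0%R, 1%R].
pose path c t := H (c, t).
have cpath c : {within I, continuous path c}.
  apply: (@within_comp _ _ _ _ (cylinder R X) (fun t : R => (c, t)) H) => //.
  by apply: continuous_pair => t; [exact: cvg_cst | exact: cvg_id].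
have mono t a b : I t -> lt a b -> le (path a t) (path b t).
  move=> It.
  apply: (continuous_monotone (f := fun y => H (y, t)) openE openE) => //.
  apply/continuous_subspace_setT.
  apply: (@within_comp _ _ _ _ (cylinder R X) (fun y : X => (y, t)) H) => //.
  by apply: continuous_pair => y; [exact: cvg_id | exact: cvg_cst].
pose fixed t :=
  [/\ path v t = v, path v' t = v', path w t = w & path w' t = w'].
pose D c : set (subspace I) := path c @^-1` [set z | le z c].
pose U c : set (subspace I) := path c @^-1` [set z | le c z].
have Dv t a b : lt a b -> D a t -> path a t = a.
  by move=> ab [//|h]; case: (lt_height1 h ab).
have Uw t a b : lt a b -> U b t -> path b t = b.
  by move=> ab [//|h]; case: (lt_height1 ab h).
(* A point strictly below [b] is minimal, so [v] and [v'] could lie weakly below it only by both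
   being equal to it. *)
have Dw t b : I t -> lt v b -> lt v' b -> path v t = v -> path v' t = v' ->
    D b t -> path b t = b.
  move=> It vb v'b pv pv' [//|pb].
  have := mono _ _ _ It v'b; have := mono _ _ _ It vb; rewrite pv pv'.
  move=> [<-|/lt_height1 /(_ pb)//] [/esym//|h].
  by case: (lt_height1 h vb).
have Uv t a : I t -> lt a w -> lt a w' -> path w t = w -> path w' t = w' ->
    U a t -> path a t = a.
  move=> It aw aw' pw pw' [//|pa].
  have := mono _ _ _ It aw'; have := mono _ _ _ It aw; rewrite pw pw'.
  move=> [->|h]; last by case: (lt_height1 pa h).
  by move=> [//|h]; case: (lt_height1 aw h).
have fixedD t : I t -> (D v `&` D v' `&` D w `&` D w') t -> fixed t.
  move=> It [[[/Dv-/(_ _ vw) pv /Dv-/(_ _ v'w) pv'] pw] pw'].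
  by split => //; exact: Dw.
have fixedU t : I t -> (U v `&` U v' `&` U w `&` U w') t -> fixed t.
  move=> It [[[pv pv'] /Uw-/(_ _ vw) pw] /Uw-/(_ _ vw') pw'].
  by split => //; exact: Uv.
have oD c : open (D c).
  by move/continuousP: (cpath c); apply; exact: open_downset.
have cU c : closed (U c).
  by move/continuous_closedP: (cpath c); apply; exact: closed_upset.
have fixedI : I `&` fixed = I.
  have sc : connected I := @segment_connected R 0%R 1%R.
  apply: sc.
  - exists 0%R; split; last by split; exact: H0.
    by rewrite /I /= in_itv/= lexx ler01.
  - have /open_subspaceP[C oC CI] : open (D v `&` D v' `&` D w `&` D w').
      by do 3! [apply: openI => //].
    exists C => //; rewrite [RHS]setIC CI; apply/seteqP; split=> t.
      move=> [It [pv pv' pw pw']]; split=> //.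
      by split; [split; [split|]|]; left.
    by move=> [Dt It]; split=> //; exact: fixedD.
  - have /closed_subspaceP[C oC CI] : closed (U v `&` U v' `&` U w `&` U w').
      by do 3! [apply: closedI => //].
    exists C => //; rewrite [RHS]setIC CI; apply/seteqP; split=> t.
      move=> [It [pv pv' pw pw']]; split=> //.
      by split; [split; [split|]|]; left.
    by move=> [Ut It]; split=> //; exact: fixedU.
have : I 1%R by rewrite /I /= in_itv/= lexx ler01.
by rewrite -fixedI => -[_ [pv _ pw _]]; case: xvw => ->.
Qed.

Lemma homotopic_id_eq (A : set X) (f : X -> X) : (forall x, on_square x) ->
  homotopic_rel R A f idfun -> f = idfun.
Proof.
move=> sq /homotopic_rel_sym[H [cH H0 H1 _]]; apply/funext => x.
by rewrite -H1; exact: homotopy_fixes_square.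
Qed.

End square_rigidity.

(** * Well-orders and their rigidity *)

Section well_order_theory.
Context (T : eqType) (r : rel T).
Context (r_wo : well_order r).

Lemma well_order_min (P : set T) : P !=set0 ->
  exists2 z, P z & forall x, P x -> r z x.
Proof.
move=> [x Px]; have [|z [[zP zmin] _]] := @r_wo [pred x | `[< P x >]].
  by exists x; apply/asboolP.
by exists z; [exact/asboolP|move=> y Py; apply: zmin; apply/asboolP].
Qed.

Lemma well_order_total : total r.
Proof.
move=> x y; have [|z [->|->] zmin] := @well_order_min [set z | z = x \/ z = y].
- by exists x; left.
- by rewrite zmin//; right.
- by rewrite orbC zmin//; left.
Qed.

Lemma well_order_refl : reflexive r.
Proof. by move=> x; rewrite -[r x x]orbb well_order_total. Qed.

(** Both points would be minima of the pair, and minima are unique. *)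
Lemma well_order_anti : antisymmetric r.
Proof.
move=> x y /andP[xy yx].
have [|z [_ uz]] := @r_wo [pred z | (z == x) || (z == y)].
  by exists x; rewrite inE eqxx.
rewrite -(uz x) ?(uz y)//; split; rewrite ?inE ?eqxx ?orbT// => t;
  by rewrite inE => /orP[] /eqP ->; rewrite ?well_order_refl.
Qed.

Lemma well_order_trans : transitive r.
Proof.
move=> y x z xy yz.
have [|t] := @well_order_min [set t | [\/ t = x, t = y | t = z]].
  by exists x; constructor.
case=> -> tmin; first by apply: tmin; constructor.
- have /tmin yx : [\/ x = x, x = y | x = z] by constructor.
  by have -> : x = y by apply: well_order_anti; rewrite xy.
- have /tmin zy : [\/ y = x, y = y | y = z] by constructor.
  by have <- : y = z by apply: well_order_anti; rewrite yz.
Qed.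

(** Let [z] be the least point moved by [f]. Whichever of [f z] and [g z] lies below [z] is fixed by
    minimality, and injectivity then makes [z] fixed. *)
Lemma well_order_rigid (f g : T -> T) : cancel f g -> cancel g f ->
  {homo f : x y / r x y} -> {homo g : x y / r x y} -> f =1 id.
Proof.
move=> fK gK fr gr x; apply: contrapT => fx.
have [|z /= fz zmin] := @well_order_min [set z | f z <> z]; first by exists x.
have fixlt y : r y z -> y <> z -> f y = y.
  move=> yz yNz; apply: contrapT => /zmin zy.
  by apply: yNz; apply: well_order_anti; rewrite yz.
have /orP[fzz|zfz] := well_order_total (f z) z.
  by apply: (fz); apply: (can_inj fK); exact: fixlt.
have gz : g z <> z.
  by move=> gz; apply: fz; rewrite -[in LHS]gz gK.
have gzz : r (g z) z by rewrite -[X in r _ X]fK gr.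
by apply: (gz); rewrite -[LHS](fixlt _ gzz gz) gK.
Qed.

End well_order_theory.

Definition well_le (T : Type) : rel T :=
  sval (well_ordering_principle {classic T}).

Lemma well_le_well_order (T : Type) : well_order (@well_le {classic T}).
Proof. exact: svalP. Qed.

Lemma well_le_refl (T : Type) (x : T) : well_le x x.
Proof. exact: (@well_order_refl {classic T} _ (@well_le_well_order T)). Qed.

Lemma well_le_anti (T : Type) (x y : T) : well_le x y -> well_le y x -> x = y.
Proof.
move=> xy yx; apply: (@well_order_anti {classic T} _ (@well_le_well_order T)).
by rewrite xy.
Qed.

Lemma well_le_trans (T : Type) (x y z : T) :
  well_le x y -> well_le y z -> well_le x z.
Proof. exact: (@well_order_trans {classic T} _ (@well_le_well_order T)). Qed.

(** * The poset encoding the 3-net *)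

Section space.
Context (G : groupType) (S : Type).

(* The minimal points other than [base] and [low]: columns [inl (true, h)],
   rows [inl (false, g)] and colours [inr c]; [S] provides the colours that
   belong to no cell. *)
Definition label : Type := (bool * G) + (G + S).
(** All columns share one rank and all rows another, while each colour has its own: fixing ranks
    pins the colours and leaves rows and columns free to move among themselves. *)
Definition rank (l : label) : bool + (G + S) :=
  match l with inl (b, _) => inl b | inr c => inr c end.

(* The well-order on ranks is read off the maximal points [mark i], which are
   recognized, apart from [top], by lying above the base point [base].  The
   points [low] and [top] tell [top] apart from a last mark and put every point
   on a square. *)
Inductive space : Type :=
  | base | low | line of label
  | mark of bool + (G + S) | top | cell of G & G.

Definition incident (l : label) (g h : G) : Prop :=
  match l with
  | inl (b, k) => k = if b then h else g
  | inr c => c = inl (g^-1 * h)%g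
  end.

Definition below (x y : space) : Prop :=
  match x, y with
  | base, mark _ | base, top | low, top | low, cell _ _ | line _, top => True
  | line l, mark i => well_le (rank l) i
  | line l, cell g h => incident l g h
  | _, _ => False
  end.

HB.instance Definition _ := gen_eqMixin space.
HB.instance Definition _ := gen_choiceMixin space.
HB.instance Definition _ := isPointed.Build space base.

Definition space_open (U : set space) : Prop :=
  forall x y, below x y -> U y -> U x.

Lemma space_openT : space_open setT.
Proof. by []. Qed.

Lemma space_openI : setI_closed space_open.
Proof.
by move=> U V Uo Vo x y xy [Uy Vy]; split; [exact: Uo Uy | exact: Vo Vy].
Qed.

Lemma space_open_bigU (I : Type) (f : I -> set space) :
  (forall i, space_open (f i)) -> space_open (\bigcup_i f i).
Proof. by move=> fo x y xy [i _ fiy]; exists i => //; exact: fo fiy. Qed.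

HB.instance Definition _ :=
  isOpenTopological.Build space space_openT space_openI space_open_bigU.

Lemma space_openE (U : set space) :
  open U <-> (forall x y, below x y -> U y -> U x).
Proof. by []. Qed.

Lemma below_height1 (x y z : space) : below x y -> ~ below y z.
Proof.
by move=> xy yz; case: y z yz xy => [||?|?||? ?] [||?|?||? ?] // _; case: x.
Qed.

(** The unit is an arbitrary choice of a row or column of the given rank. *)
Definition line_of (i : bool + (G + S)) : label :=
  match i with inl b => inl (b, 1%g) | inr c => inr c end.

Lemma rank_line_of i : rank (line_of i) = i.
Proof. by case: i. Qed.

Lemma space_on_square (x : space) : on_square below x.
Proof.
case: x => [||l|i||g h].
- by exists base, (line (inl (true, 1%g))), (mark (inl true)), top;
    split; split=> //=; by [exact: well_le_refl | left].
- by exists low, (line (inl (true, 1%g))), (cell 1%g 1%g), top;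
    split; split=> //=; by [exact: well_le_refl | left].
- by exists (line l), base, (mark (rank l)), top;
    split; split=> //=; by [exact: well_le_refl | left].
- exists base, (line (line_of i)), (mark i), top; split; split=> //=.
    by rewrite rank_line_of well_le_refl.
  by right.
- by exists base, (line (inl (true, 1%g))), top, (mark (inl true));
    split; split=> //=; by [exact: well_le_refl | right].
- by exists low, (line (inl (true, h))), (cell g h), top;
    split; split=> //=; by [exact: well_le_refl | right].
Qed.

(** * Points and ranks preserved by automorphisms *)

Section automorphism.
Implicit Types f g : space -> space.

(** The inverse is explicit because a monotone bijection may have a non-monotone inverse, and
    because every argument is also applied to [g]. *)
Definition automorphism f g : Prop :=
  [/\ cancel f g, cancel g f & f base = base] /\
  ((forall x y, below x y -> below (f x) (f y)) /\
   (forall x y, below x y -> below (g x) (g y))).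

Lemma automorphism_sym f g : automorphism f g -> automorphism g f.
Proof.
by move=> [[fK gK fb] [fm gm]]; split=> //; split=> //; rewrite -fb fK.
Qed.

Lemma below_top (x y : space) : below x y -> below x top.
Proof. by case: x. Qed.

(** Only [top] lies above both [base] and [low]. So does [f top]: [g low] is below something, hence
    below [top]. *)
Lemma automorphism_top f g : automorphism f g -> f top = top.
Proof.
move=> [[fK gK fb] [fm gm]].
have := fm base top I; rewrite fb; case E: (f top) => [||||//|]// _.
by have := fm _ _ (below_top (gm low top I)); rewrite gK E.
Qed.

Lemma automorphism_mark f g i :
  automorphism f g -> exists j, f (mark i) = mark j.
Proof.
move=> fg; have ftop := automorphism_top fg; case: fg => [[fK gK fb] [fm gm]].
have := fm base (mark i) I; rewrite fb; case E: (f (mark i)) => [|||j||]// _.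
  by exists j.
by have := congr1 g E; rewrite -ftop !fK.
Qed.

(** The order on indices says that everything below [mark i] is below [mark j], a condition that [f]
    and [g] transport. *)
Lemma automorphism_mark_le f g i i' j j' : automorphism f g ->
  f (mark i) = mark i' -> f (mark j) = mark j' -> well_le i j -> well_le i' j'.
Proof.
move=> [[fK gK _] [fm gm]] fi fj ij.
have : below (line (line_of i')) (mark i').
  by rewrite /= rank_line_of well_le_refl.
move=> /gm; rewrite -fi fK => gi'.
have : below (g (line (line_of i'))) (mark j).
  by case: (g _) gi' => //= l li; exact: well_le_trans li ij.
by move=> /fm; rewrite gK fj /= rank_line_of.
Qed.

Lemma automorphism_mark_id f g i : automorphism f g -> f (mark i) = mark i.
Proof.
move=> fg; have gf := automorphism_sym fg.
have [s fs] := choice (fun i => automorphism_mark i fg).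
have [t gt] := choice (fun i => automorphism_mark i gf).
rewrite fs; congr mark.
have [[fK gK _] _] := fg.
apply: (@well_order_rigid {classic _} _ (@well_le_well_order _) s t).
(* The [if] inverts the constructor [mark]; its default [j] is never reached. *)
- by move=> j; apply: (congr1 (fun x => if x is mark k then k else j)
    (_ : mark (t (s j)) = mark j)); rewrite -gt -fs fK.
- by move=> j; apply: (congr1 (fun x => if x is mark k then k else j)
    (_ : mark (s (t j)) = mark j)); rewrite -fs -gt gK.
- by move=> j k; apply: automorphism_mark_le fg _ _.
- by move=> j k; apply: automorphism_mark_le gf _ _.
Qed.

Lemma automorphism_rank_le f g l l' : automorphism f g ->
  f (line l) = line l' -> well_le (rank l') (rank l).
Proof.
move=> fg fl; have fmark := automorphism_mark_id (rank l) fg.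
have [_ [fm _]] := fg.
by have := fm (line l) (mark (rank l)) (well_le_refl _); rewrite fl fmark.
Qed.

(** The image cannot be [base], which is fixed, nor [low], which is below no mark. As marks are
    fixed, comparing ranks through [f] and through [g] gives equality. *)
Lemma automorphism_line f g l : automorphism f g ->
  exists2 l', f (line l) = line l' & rank l' = rank l.
Proof.
move=> fg; have [[fK gK fb] [fm gm]] := fg; have gf := automorphism_sym fg.
have := below_top (fm (line l) top I).
case E: (f (line l)) => [||l'|||]// _.
- by have := congr1 g E; rewrite fK -fb fK.
- have := fm (line l) (mark (rank l)) (well_le_refl _).
  by rewrite E (automorphism_mark_id _ fg).
- exists l' => //; apply: well_le_anti; first exact: automorphism_rank_le fg E.
  by apply: automorphism_rank_le gf _; rewrite -E fK.
Qed.

Lemma automorphism_low f g : automorphism f g -> f low = low.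
Proof.
move=> fg; have [[fK gK fb] [fm gm]] := fg; have gf := automorphism_sym fg.
have := below_top (fm low top I); case E: (f low) => [||l|||]// _.
- by have := congr1 g E; rewrite fK -fb fK.
- by have [l' + _] := automorphism_line l gf; rewrite -E fK.
Qed.

Lemma automorphism_cell f g h k : automorphism f g ->
  exists h' k', f (cell h k) = cell h' k'.
Proof.
move=> fg; have [[fK gK fb] [fm gm]] := fg.
have := fm low (cell h k) I; rewrite (automorphism_low fg).
case E: (f (cell h k)) => [|||||h' k']// _; last by exists h', k'.
by have := congr1 g E; rewrite fK -(automorphism_top fg) fK.
Qed.

End automorphism.

(** * Automorphisms are left translations *)

Definition translate_label (u : G) (l : label) : label :=
  match l with inl (b, g) => inl (b, (u * g)%g) | inr c => inr c end.

Definition translate (u : G) (x : space) : space :=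
  match x with
  | line l => line (translate_label u l)
  | cell g h => cell (u * g)%g (u * h)%g
  | _ => x
  end.

Lemma translate_below u x y :
  below x y -> below (translate u x) (translate u y).
Proof.
case: x => [||[[b g]|c]|i||g h]; case: y => //= h k.
  by move=> ->; case: b.
by move=> ->; rewrite invgM -mulgA mulKg.
Qed.

Lemma translate1 : translate 1%g = idfun.
Proof. by apply/funext => -[||[[b g]|c]|i||g h] //=; rewrite !mul1g. Qed.

Lemma translateM u v : translate (u * v)%g = translate u \o translate v.
Proof. by apply/funext => -[||[[b g]|c]|i||g h] //=; rewrite !mulgA. Qed.

Lemma translate_inj : injective translate.
Proof.
move=> u v /(congr1 (fun f => f (cell 1%g 1%g))) /= [].
by rewrite !mulg1.
Qed.

Lemma automorphism_translate f g :
  automorphism f g -> exists u, f = translate u.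
Proof.
move=> fg; have [[fK gK fb] [fm gm]] := fg.
have /choice[s fs] (bg : bool * G) :
    exists h, f (line (inl bg)) = line (inl (bg.1, h)).
  have [[[b' h]|c] ->] := automorphism_line (inl bg) fg;
    case: bg => b k //= [<-].
  by exists h.
have fcolor c : f (line (inr c)) = line (inr c).
  by have [[[b' h]|c'] -> //= [->]] := automorphism_line (inr c) fg.
have fcell h k : f (cell h k) = cell (s (false, h)) (s (true, k)).
  have [h' [k' E]] := automorphism_cell h k fg.
  have := fm (line (inl (false, h))) (cell h k) erefl; rewrite fs E /= => ->.
  by have := fm (line (inl (true, k))) (cell h k) erefl; rewrite fs E /= => ->.
(* The colour of each cell is fixed. Taking [h = 1] here determines the action on columns, and
   [k = h] then the action on rows. *)
have sV h k : ((s (false, h))^-1 * s (true, k))%g = (h^-1 * k)%g.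
  have := fm (line (inr (inl (h^-1 * k)%g))) (cell h k) erefl.
  by rewrite fcolor fcell /= => -[].
pose u := s (false, 1%g).
have st k : s (true, k) = (u * k)%g.
  by have /(congr1 (fun a => u * a)%g) := sV 1%g k; rewrite mulVKg invg1 mul1g.
have sf h : s (false, h) = (u * h)%g.
  have := sV h h; rewrite mulVg st => /(congr1 (fun a => s (false, h) * a)%g).
  by rewrite mulVKg mulg1.
exists u; apply/funext => -[||[[b h]|c]|i||h k] /=.
- exact: fb.
- exact: automorphism_low fg.
- by case: b; rewrite fs ?st ?sf.
- exact: fcolor.
- exact: automorphism_mark_id fg.
- exact: automorphism_top fg.
- by rewrite fcell sf st.
Qed.

End space.

(** * The group of pointed self-equivalences *)

Section self_equivalences_of_space.
Context (R : realType) (G : groupType).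

Lemma space_alexandroff (S : Type) : alexandroff (space G S).
Proof. exact: (downset_alexandroff (@space_openE G S)). Qed.

Lemma continuous_below (S T : Type) (f : space G S -> space G T) :
  continuous f <->
  (forall x y, below x y -> f x = f y \/ below (f x) (f y)).
Proof.
split=> [cf x y|mf].
  exact: (continuous_monotone (@space_openE G S) (@space_openE G T)
    (@below_height1 G T) cf).
apply/continuousP => U /space_openE Uo; apply/space_openE => x y xy /= Uy.
by have [->//|fxy] := mf x y xy; exact: Uo fxy Uy.
Qed.

Lemma space_homotopic_id (S : Type) (A : set (space G S))
    (f : space G S -> space G S) :
  homotopic_rel R A f idfun -> f = idfun.
Proof.
exact: (homotopic_id_eq (@space_openE G S) (@below_height1 G S)
  (@space_on_square G S)).
Qed.

Lemma translate_self_equivalence (S : Type) (u : G) :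
  pointed_homotopy_equivalence R (@translate G S u).
Proof.
have pt v : pointed_map (@translate G S v).
  by split=> //; apply/continuous_below => x y /translate_below; right.
split; first exact: pt.
exists (translate u^-1); split; first exact: pt.
  rewrite -translateM mulVg translate1.
  by apply: homotopic_rel_refl => x; exact: cvg_id.
rewrite -translateM mulgV translate1.
by apply: homotopic_rel_refl => x; exact: cvg_id.
Qed.

Lemma self_equivalence_translate (S : Type) (f : space G S -> space G S) :
  pointed_homotopy_equivalence R f -> exists u, f = translate u.
Proof.
(* Continuity yields only weak monotonicity; injectivity makes it strict. *)
have strict (k h : space G S -> space G S) x y : continuous k -> cancel k h ->
    below x y -> below (k x) (k y).
  move=> /continuous_below km kK xy; have [kxy|//] := km _ _ xy.
  by move: xy; rewrite (can_inj kK kxy) => yy; case: (below_height1 yy yy).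
move=> [[cf fb] [g [[cg gb] /space_homotopic_id gf /space_homotopic_id fg]]].
have fK : cancel f g by move=> x; exact: (congr1 (fun h => h x) gf).
have gK : cancel g f by move=> x; exact: (congr1 (fun h => h x) fg).
apply: (@automorphism_translate _ _ f g); split; first by split.
by split=> x y; apply: strict; eassumption.
Qed.

(** Composing with the translation by [v^-1] gives a homotopy ending at the identity, where rigidity
    applies. *)
Lemma pointed_homotopic_translate (S : Type) (u v : G) :
  pointed_homotopic R (@translate G S u) (translate v) -> u = v.
Proof.
have [[cv _] _] := translate_self_equivalence S v^-1.
move=> /(homotopic_rel_compl cv); rewrite -!translateM mulVg translate1.
move=> /space_homotopic_id; rewrite -translate1 => /translate_inj.
move=> /(congr1 (fun a => v * a)%g).
by rewrite mulVKg mulg1.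
Qed.

Definition translation_of (S : Type)
    (a : self_equivalence_group R (space G S)) : G :=
  projT1 (cid (self_equivalence_translate (self_equivalenceP (repr a)))).

Lemma translation_ofE (S : Type) (a : self_equivalence_group R (space G S)) :
  val (repr a) = translate (translation_of a).
Proof. by rewrite /translation_of; case: cid. Qed.

Lemma translation_of_mul (S : Type) :
  {morph @translation_of S : a b / (a * b)%g >-> (a * b)%g}.
Proof.
move=> a b; apply: (@pointed_homotopic_translate S).
rewrite translateM -!translation_ofE.
apply/(self_pi_eq (repr (a * b)%g) (self_equivalence_mul (repr a) (repr b))).
by rewrite reprK.
Qed.

HB.instance Definition _ (S : Type) := isMultiplicative.Build
  (self_equivalence_group R (space G S)) G (@translation_of S)
  (@translation_of_mul S).

Lemma self_equivalence_group_space (S : Type) :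
  group_isomorphic (self_equivalence_group R (space G S)) G.
Proof.
exists (@translation_of S).
pose tr u : self_equivalence R (space G S) :=
  SigSub (mem_set (translate_self_equivalence S u)).
exists (fun u => \pi_(self_equivalence_group R (space G S))%qT (tr u)) => [a|u].
  rewrite -[RHS]reprK; apply/self_pi_eq; rewrite /= -translation_ofE.
  by apply: homotopic_rel_refl; case: (self_equivalenceP (repr a)) => -[].
apply: (@pointed_homotopic_translate S); rewrite -translation_ofE.
by apply/(self_pi_eq (repr _) (tr u)); rewrite reprK.
Qed.

Lemma homotopy_equivalent_space_inj (S T : Type) :
  homotopy_equivalent R (space G S) (space G T) ->
  exists f : space G S -> space G T, injective f.
Proof.
move=> [f [g [_ _ /space_homotopic_id gf _]]]; exists f.
by apply: (can_inj (g := g)) => x; exact: (congr1 (fun h => h x) gf).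
Qed.

End self_equivalences_of_space.

(** * Spaces of strictly increasing cardinality *)

Lemma no_powerset_injection (T : Type) (f : set T -> T) : ~ injective f.
Proof.
(* Cantor's diagonal set, for an injection out of the powerset. *)
move=> finj; pose D := [set x | exists2 A, f A = x & ~ A x].
have nDfD : ~ D (f D) by move=> [A /finj -> nD]; apply: (nD); exists D.
by apply: (nDfD); exists D.
Qed.

(** Sets of points of one space become free colours of the next, which thus contains the powerset of
    its predecessor. *)
Fixpoint iterated_powerset (G : groupType) (n : nat) : Type :=
  if n is m.+1 then set (space G (iterated_powerset G m)) else unit.

Lemma iterated_powerset_inj (G : groupType) (n : nat) :
  exists f : iterated_powerset G n.+1 -> space G (iterated_powerset G n.+1),
    injective f.
Proof. by exists (fun A => line (inr (inr A))) => A B []. Qed.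

Lemma space_tower_inj (G : groupType) (m n : nat) : (m <= n)%N ->
  exists f : space G (iterated_powerset G m) -> space G (iterated_powerset G n),
    injective f.
Proof.
elim: n => [|n IHn]; first by rewrite leqn0 => /eqP ->; exists id.
rewrite leq_eqVlt ltnS => /orP[/eqP -> |/IHn[f finj]]; first by exists id.
have [h hinj] := iterated_powerset_inj G n.
(* Singletons embed a space in its powerset, hence in the next space. *)
exists (fun x => h [set f x]) => x y /hinj fxy; apply: finj.
by have : [set f x] (f x) by []; rewrite fxy.
Qed.

Theorem theorem1p4 (R : realType) (G : groupType) :
  exists X : nat -> ptopologicalType,
    (forall n : nat, alexandroff (X n)) /\
    (forall m n : nat, m <> n -> ~ homotopy_equivalent R (X m) (X n)) /\
    (forall n : nat, group_isomorphic (self_equivalence_group R (X n)) G).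
Proof.
exists (fun n => space G (iterated_powerset G n)); split; last split.
- by move=> n; exact: space_alexandroff.
- have lt_not_equiv m n : (m < n)%N -> ~ homotopy_equivalent R
      (space G (iterated_powerset G n)) (space G (iterated_powerset G m)).
    (* The powerset of space [n] injects into space [n.+1], thence by the equivalence into space
       [m], and so into space [n], against Cantor. *)
    case: n => // n; rewrite ltnS => /(space_tower_inj G)[f finj].
    move=> /homotopy_equivalent_space_inj[k kinj].
    have [h hinj] := iterated_powerset_inj G n.
    exact: (@no_powerset_injection _ (fun A => f (k (h A))))
      (inj_comp finj (inj_comp kinj hinj)).
  move=> m n mn; have [lt_mn [f [g [cf cg gf fg]]]|lt_nm|//] := ltngtP m n.
    by apply: (lt_not_equiv _ _ lt_mn); exists g, f.
  exact: lt_not_equiv.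
- by move=> n; exact: self_equivalence_group_space.
Qed.
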